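(* Fix $p\in(0,1)$ and $\epsilon>0$. For each $n$, let the communication graph be a single directed Erdős–Rényi random graph $G(n,p)$ on $n$ nodes, used in every round (i.e. $G_t=G_1$ for all $t$). For an algorithm $R'$, let $T^{\rm all}_n(R')$ be the number of rounds until every node has received every node's packet when all nodes run $R'$. Then $$\lim_{n\to\infty}\mathbb P\Bigl(T^{\rm all}_n(R1)>\tfrac{2(1+\epsilon)}{p}\log n\Bigr)=0,\qquad \lim_{n\to\infty}\mathbb P\Bigl(T^{\rm all}_n(R2)>\tfrac{2(1+\epsilon)}{p^2}\log n\Bigr)=0,$$ where probabilities are over the randomness of both the graph and the algorithm.
   Context: A directed Erdős–Rényi random graph $G(n,p)$ has each ordered pair $(u,v)$, $u\ne v$, present independently with probability $p$; a broadcast by $u$ in any round is received by exactly the nodes $v$ with $(u,v)$ an edge. Each node initially holds one distinct packet and broadcasts exactly one packet per round. Algorithms R1 and R2: in round 1 each node broadcasts its own packet. Each node stores all packets received. In each round $t\ge2$, each node broadcasts a packet chosen uniformly at random from (R1) the set of packets it received in round 1, or (R2) the set of all packets it received in rounds $1,\ldots,t-1$. All these random choices are mutually independent across nodes and rounds (and independent of the graph given the received sets). *)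

(* Defs.v *)
From HB Require Import structures.
From mathcomp Require Import all_boot all_order all_algebra.
From mathcomp Require Import all_classical all_reals all_analysis.
From mathcomp Require Import finset.
Set Implicit Arguments. Unset Strict Implicit. Unset Printing Implicit Defensive.
Import Order.TTheory GRing.Theory Num.Theory.
Local Open Scope ring_scope.

(* Nodes are 'I_n; packet of node u is identified with u.
   A directed graph is a set E of ordered pairs (u,v) = edge u -> v. *)
Definition graph (n : nat) := {set 'I_n * 'I_n}.

Definition gnp_weight {R : realType} (n : nat) (p : R) (E : graph n) : R :=
  \prod_(e : 'I_n * 'I_n)
     (if e.1 == e.2 then (e \notin E)%:R
      else if e \in E then p else 1 - p).

(* State after some rounds: S w = set of packets node w has received so far. *)
Definition state (n : nat) := {ffun 'I_n -> {set 'I_n}}.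

Definition state0 (n : nat) : state n := [ffun _ => set0].

(* One round: b v = Some x if node v broadcasts packet x, None if silent.
   Node w receives the packets broadcast by its in-neighbours. *)
Definition step (n : nat) (E : graph n) (S : state n)
    (b : {ffun 'I_n -> option 'I_n}) : state n :=
  [ffun w => S w :|: [set x | [exists v, ((v, w) \in E) && (b v == Some x)]]].

Definition own_bcast (n : nat) : {ffun 'I_n -> option 'I_n} := [ffun v => Some v].

(* Every node has every node's packet (its own packet it holds initially). *)
Definition complete (n : nat) (S : state n) : bool :=
  [forall w : 'I_n, forall u : 'I_n, (u == w) || (u \in S w)].

Inductive algo := R1 | R2.

(* Set of packets received in round 1 = in-neighbours (graph is fixed). *)
Definition in_nbrs (n : nat) (E : graph n) (v : 'I_n) : {set 'I_n} :=
  [set u | (u, v) \in E].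

Definition pool (n : nat) (a : algo) (E : graph n) (S : state n) (v : 'I_n)
  : {set 'I_n} :=
  match a with R1 => in_nbrs E v | R2 => S v end.

Definition bcast_weight {R : realType} (n : nat) (pl : 'I_n -> {set 'I_n})
    (b : {ffun 'I_n -> option 'I_n}) : R :=
  \prod_(v : 'I_n)
    (if pl v == set0 then (b v == None)%:R
     else match b v with
          | Some x => (x \in pl v)%:R / #|pl v|%:R
          | None => 0
          end).

(* notdone a E k t S = probability that, starting from state S after t rounds,
   the dissemination is still not complete after k further rounds. *)
Fixpoint notdone {R : realType} (n : nat) (a : algo) (E : graph n)
    (k t : nat) (S : state n) : R :=
  match k with
  | 0 => if complete S then 0 else 1
  | k'.+1 =>
      if t == 0 then notdone a E k' 1 (step E S (own_bcast n))
      else \sum_(b : {ffun 'I_n -> option 'I_n})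
             bcast_weight (pool a E S) b * notdone a E k' t.+1 (step E S b)
  end.

(* P(T^all_n(a) > K) for an integer number of rounds K: the process is not
   complete after K rounds, averaging over G(n,p) and the algorithm's choices. *)
Definition prob_T_gt {R : realType} (n : nat) (p : R) (a : algo) (K : nat) : R :=
  \sum_(E : graph n) gnp_weight p E * notdone a E K 0 (state0 n).

(* P(T^all_n(a) > x) for a real threshold x >= 0: T > x iff T > floor x. *)
Definition prob_T_gt_real {R : realType} (n : nat) (p : R) (a : algo) (x : R) : R :=
  prob_T_gt n p a (Num.truncn x).

(* Main.v *)
(* Let I_v be the in-neighbourhood of v.  After round 1, in each round node w
   misses packet x with conditional probability at most
   prod_v (1 - [x in I_v][v in I_w] / D_v), where D_v = |I_v| for R1 and D_v = n
   for R2.  Over k rounds the v-th factor is at most 1 - k / (k + D_v) by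
   Bernoulli's inequality.  This bound is averaged over the graph without any
   concentration estimate: conditionally on I_w the factors depend on the
   independent sets I_v, and Jensen's inequality for y |-> 1/y replaces |I_v| by
   its mean, so the average is at most (1 - p^2 k / (k + 1 + n m))^(n-2) with
   m = p for R1 and m = 1 for R2.  For k ~ 2 (1 + eps) (m / p^2) ln n this is
   about n^(-2 (1 + eps)), which beats the n^2 pairs (x, w). *)

Require Import Defs.
From HB Require Import structures.
From mathcomp Require Import all_boot all_order all_algebra.
From mathcomp Require Import all_classical all_reals all_analysis.
From mathcomp Require Import finset.
From mathcomp Require Import ring lra.
Set Implicit Arguments. Unset Strict Implicit. Unset Printing Implicit Defensive.
Import Order.TTheory GRing.Theory Num.Theory numFieldNormedType.Exports.
Local Open Scope classical_set_scope.
Local Open Scope ring_scope.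

(** * Sums over optional broadcasts and a Bernoulli estimate *)

Lemma big_option (R : Type) (idx : R) (op : Monoid.com_law idx) (T : finType)
    (F : option T -> R) :
  \big[op/idx]_o F o = op (F None) (\big[op/idx]_x F (Some x)).
Proof.
rewrite (bigD1 None) //=; congr (op _ _).
rewrite (reindex_omap Some id) /=; last by case.
by apply: eq_bigl => x; rewrite eqxx.
Qed.

Lemma sum_set_singleton (R : realType) (T : finType) (A : {set T}) :
  A != finset.set0 -> \sum_x (x \in A)%:R / #|A|%:R = 1 :> R.
Proof.
move=> A0; rewrite -mulr_suml -natr_sum.
rewrite [X in X%:R / _](_ : _ = #|A|).
  by rewrite divff // pnatr_eq0 -lt0n card_gt0.
by rewrite -sum1_card [RHS]big_mkcond; apply: eq_bigr => x _; case: (x \in A).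
Qed.

(** Bernoulli gives (1 + y)^k >= 1 + k y, and (1 - y)^k (1 + y)^k = (1 - y^2)^k <= 1. *)
Lemma onemX_le (R : realType) (y : R) (k : nat) :
  0 <= y <= 1 -> (1 - y) ^+ k <= (1 + k%:R * y)^-1.
Proof.
move=> /andP[y0 y1].
have ky0 : 0 <= k%:R * y by rewrite mulr_ge0.
rewrite -[leRHS]mul1r ler_pdivlMr; last by lra.
have B : 1 + k%:R * y <= (1 + y) ^+ k.
  elim: {ky0} k => [|k IH]; first by rewrite expr0; lra.
  rewrite exprS -natr1.
  apply: (@le_trans _ _ ((1 + y) * (1 + k%:R * y))); last by rewrite ler_wpM2l //; lra.
  have : 0 <= k%:R * y * y by rewrite !mulr_ge0.
  lra.
apply: (le_trans (ler_wpM2l _ B)); first by rewrite exprn_ge0 //; lra.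
rewrite -exprMn exprn_ile1 //; first by rewrite mulr_ge0; lra.
have : 0 <= y * y by rewrite mulr_ge0.
lra.
Qed.

(** This is one node's factor of the miss probability, with [c] telling whether the node has an edge
    to the receiver. With an empty pool the node is silent and both sides are 1. *)
Lemma sum_option_weight (R : realType) (T : finType) (P : {set T}) (x : T) (c : bool) :
  \sum_(o : option T) (if P == finset.set0 then (o == None)%:R
     else match o with Some y => (y \in P)%:R / #|P|%:R | None => 0 end)
     * (1 - (c && (o == Some x))%:R)
   = 1 - ((x \in P) && c)%:R / #|P|%:R :> R.
Proof.
rewrite big_option /=; case: eqP => [->|/eqP P0].
  by rewrite big1 ?in_set0 ?andbF /= ?mul0r ?subr0 ?mulr1 ?addr0 // => y _; rewrite mul0r.
rewrite mul0r add0r.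
under eq_bigr do rewrite mulrBr mulr1.
rewrite sumrB sum_set_singleton //; congr (_ - _).
rewrite (bigD1 x) //= eqxx andbT big1 ?addr0; last first.
  by move=> y yx; rewrite (_ : (Some y == Some x) = false) ?andbF ?mulr0 //; exact/negbTE.
by rewrite mulrAC -natrM mulnb.
Qed.

(** * Probability of missing a packet, for a fixed graph *)

Section broadcast.
Context {R : realType} (n : nat).
Implicit Types (E : graph n) (S : state n) (I : {set 'I_n}) (pl : 'I_n -> {set 'I_n}).

Lemma bcast_weight_ge0 pl b : 0 <= bcast_weight pl b :> R.
Proof.
apply: prodr_ge0 => v _; case: ifP => // _.
by case: (b v) => // y; rewrite divr_ge0.
Qed.

(** The nodes choose independently, so the sum over all choices distributes over the product. *)
Lemma sum_bcast_weight_miss pl (c : pred 'I_n) x :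
  \sum_b bcast_weight pl b * \prod_v (1 - (c v && (b v == Some x))%:R)
  = \prod_v (1 - ((x \in pl v) && c v)%:R / #|pl v|%:R) :> R.
Proof.
under [RHS]eq_bigr do rewrite -sum_option_weight.
rewrite bigA_distr_bigA /=; apply: eq_bigr => b _.
by rewrite -big_split.
Qed.

Lemma notin_step E S b x w :
  (x \notin step E S b w)%:R
  = (x \notin S w)%:R * \prod_v (1 - (((v, w) \in E) && (b v == Some x))%:R) :> R.
Proof.
rewrite ffunE !inE negb_or.
case: (x \in S w); first by rewrite mul0r.
rewrite mul1r /=; case: existsP => [[v vP]|H].
  by rewrite (bigD1 v) //= vP subrr mul0r.
rewrite big1 // => v _; case: andP => [vP|]; last by rewrite subr0.
by case: H; exists v; apply/andP.
Qed.

(** A bound on the pool valid in every round: under [R2] the pool grows with time and is bounded by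
    [n]. *)
Definition pool_size (a : algo) (I : {set 'I_n}) : nat :=
  if a is R1 then #|I| else n.

(** Bounds from above the probability that [v] fails to deliver [x] to [w] in one round after the
    first. Only packets that [v] got in round 1 are counted, so the bound is independent of the
    state. *)
Definition miss (a : algo) E (x w v : 'I_n) : R :=
  1 - ((x \in in_nbrs E v) && (v \in in_nbrs E w))%:R
      / (pool_size a (in_nbrs E v))%:R.

Lemma miss_itv a E x w v : 0 <= miss a E x w v <= 1.
Proof.
rewrite /miss; set c := (x \in _) && _; set d := pool_size _ _.
have /andP[? ?] : 0 <= (c%:R / d%:R : R) <= 1; last by lra.
rewrite divr_ge0 //=; case: c; last by rewrite mul0r.
case: (posnP d) => [->|d0]; first by rewrite invr0 mulr0.
by rewrite mul1r invf_le1 ?ltr0n // ler1n.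
Qed.

(** Union bound over the missing pairs, by induction on the rounds left. The inclusion hypothesis is
    preserved by [step] and keeps the in-neighbourhood inside the pool for both algorithms. *)
Lemma notdone_le a E k t S : (0 < t)%N ->
  (forall v, in_nbrs E v \subset S v) ->
  notdone a E k t S <=
  \sum_(xw : 'I_n * 'I_n | xw.1 != xw.2)
     (xw.1 \notin S xw.2)%:R * \prod_v miss a E xw.1 xw.2 v ^+ k.
Proof.
elim: k t S => [|k IH] t S t0 ES /=.
  have F0 xw : 0 <= (xw.1 \notin S xw.2)%:R * \prod_v miss a E xw.1 xw.2 v ^+ 0.
    by rewrite mulr_ge0 // prodr_ge0.
  case: ifPn => [_|]; first by rewrite sumr_ge0.
  rewrite negb_forall => /existsP[w]; rewrite negb_forall => /existsP[u].
  rewrite negb_or => /andP[uw uS].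
  rewrite (bigD1 (u, w)) //= uS mul1r big1; last by move=> v _; rewrite expr0.
  by rewrite lerDl sumr_ge0.
rewrite (gtn_eqF t0).
have step_ge b v : in_nbrs E v \subset step E S b v.
  by rewrite ffunE; apply: (fintype.subset_trans (ES v)); exact: finset.subsetUl.
apply: (@le_trans _ _ (\sum_b bcast_weight (pool a E S) b *
  \sum_(xw : 'I_n * 'I_n | xw.1 != xw.2)
     (xw.1 \notin step E S b xw.2)%:R * \prod_v miss a E xw.1 xw.2 v ^+ k)).
  by apply: ler_sum => b _; rewrite ler_wpM2l ?bcast_weight_ge0 // IH.
under [leLHS]eq_bigr do rewrite mulr_sumr.
rewrite exchange_big /=; apply: ler_sum => -[x w] /= _.
set Q := \prod_v _ ^+ k.
rewrite (_ : \sum_b _ = (x \notin S w)%:R * Q * \sum_b bcast_weight (pool a E S) b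
    * \prod_v (1 - (((v, w) \in E) && (b v == Some x))%:R)); last first.
  by rewrite mulr_sumr; apply: eq_bigr => b _; rewrite notin_step /=; ring.
rewrite (sum_bcast_weight_miss _ (fun v => (v, w) \in E)) -mulrA ler_wpM2l //.
under [leRHS]eq_bigr do rewrite exprSr.
rewrite big_split /= ler_wpM2l //.
  by apply: prodr_ge0 => v _; rewrite exprn_ge0 //; case/andP: (miss_itv a E x w v).
(* The actual pool contains [in_nbrs E v] and has at most [pool_size] elements, so the true factor
   is at most [miss]. *)
have pool_sub v : in_nbrs E v \subset pool a E S v by case: (a); rewrite ?ES.
have pool_card v : (#|pool a E S v| <= pool_size a (in_nbrs E v))%N.
  by case: (a) => //=; rewrite -[leqRHS]card_ord max_card.
apply: ler_prod => v _; rewrite [(v, w) \in E](_ : _ = (v \in in_nbrs E w)); last first.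
  by rewrite inE.
set P := pool a E S v; set c := v \in _.
apply/andP; split.
  rewrite subr_ge0; case: (boolP (x \in P)) => xP; last by rewrite mul0r.
  have P0 : (0 < #|P|)%N by apply/card_gt0P; exists x.
  by rewrite ler_pdivrMr ?ltr0n // mul1r; case: c; rewrite ?ler1n ?ler0n.
rewrite lerD2l lerN2 -/c; case: (boolP (x \in in_nbrs E v)) => xI; last first.
  by rewrite mul0r divr_ge0.
have xP : x \in P := fintype.subsetP (pool_sub v) x xI.
have P0 : (0 < #|P|)%N by apply/card_gt0P; exists x.
rewrite xP ler_wpM2l // lef_pV2 ?posrE ?ltr0n ?ler_nat ?(leq_trans P0 (pool_card v)) //.
exact: pool_card.
Qed.

Definition miss_bound (a : algo) (k : nat) (x : 'I_n) (I : {set 'I_n}) : R :=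
  (x \in I)%:R * (k%:R / (k%:R + (pool_size a I)%:R)).

Lemma pool_size_gt0 a (x : 'I_n) I : x \in I -> (0 < pool_size a I)%N.
Proof.
move=> xI; case: a; rewrite /=; first by apply/card_gt0P; exists x.
exact: leq_ltn_trans (leq0n x) (ltn_ord x).
Qed.

Lemma miss_bound_itv a k x I : 0 <= miss_bound a k x I <= 1.
Proof.
rewrite /miss_bound mulr_ge0 ?divr_ge0 ?addr_ge0 //=.
case: (boolP (x \in I)) => [xI|]; last by rewrite mul0r.
have d0 := pool_size_gt0 a xI.
by rewrite mul1r ler_pdivrMr ?mul1r ?lerDl // ltr_wpDl // ltr0n.
Qed.

(** [onemX_le] at y = 1/d gives d / (d + k) = 1 - k / (k + d). Writing it with indicators covers the
    case of no delivery and prepares the averaging over the graph. *)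
Lemma missX_le a E k x w v :
  miss a E x w v ^+ k
  <= 1 - (v \in in_nbrs E w)%:R * miss_bound a k x (in_nbrs E v).
Proof.
rewrite /miss /miss_bound; set c := (x \in _) && _.
case: (boolP c) => [/andP[xI vJ]|cF].
  have d0 := pool_size_gt0 a xI.
  rewrite xI vJ; set d := pool_size _ _ in d0 *.
  have dR : (0 : R) < d%:R by rewrite ltr0n.
  apply: le_trans (onemX_le k _) _.
    by rewrite divr_ge0 //= ler_pdivrMr // mul1r ler1n.
  have k0 : (0 : R) <= k%:R by [].
  rewrite !mul1r le_eqVlt; apply/orP; left; apply/eqP; field.
  by rewrite !gt_eqF //; lra.
rewrite mul0r subr0 expr1n; move: cF; rewrite /c.
by case: (x \in _); case: (v \in _); rewrite //= ?mul0r ?mulr0 subr0.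
Qed.
End broadcast.

(** * Random subsets with independent memberships *)

Section random_subset.
Context {R : realType} (T : finType).
Implicit Types (q : T -> R) (I A : {set T}).

Definition subset_weight q I : R := \prod_u (if u \in I then q u else 1 - q u).

Lemma subset_weight_ge0 q I : (forall u, 0 <= q u <= 1) -> 0 <= subset_weight q I.
Proof.
by move=> q01; apply: prodr_ge0 => u _; have := q01 u; case: ifP => _; lra.
Qed.

Lemma sum_subset_weight_prod q (g h : T -> R) :
  \sum_I subset_weight q I * \prod_u (if u \in I then g u else h u)
  = \prod_u (q u * g u + (1 - q u) * h u).
Proof.
rewrite bigA_distr /=; apply: eq_bigr => I _.
by rewrite -big_split /=; apply: eq_bigr => u _; case: ifP.
Qed.

(** The indicator of the inclusion is a product with one factor per point, so independence
    applies. *)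
Lemma sum_subset_weight_supset q A :
  \sum_I subset_weight q I * (A \subset I)%:R = \prod_(u in A) q u.
Proof.
transitivity (\prod_u (q u * 1 + (1 - q u) * (u \notin A)%:R)); last first.
  rewrite [RHS]big_mkcond; apply: eq_bigr => u _.
  by case: (u \in A) => /=; ring.
rewrite -sum_subset_weight_prod; apply: eq_bigr => I _; congr (_ * _).
case: (boolP (A \subset I)) => [/fintype.subsetP AI|/fintype.subsetPn[u uA uI]].
  rewrite big1 // => u _; case: ifPn => // uI; case: (boolP (u \in A)) => // uA.
  by rewrite AI in uI.
by rewrite (bigD1 u) //= (negbTE uI) uA mul0r.
Qed.

Lemma sum_subset_weight q : \sum_I subset_weight q I = 1.
Proof.
rewrite -[RHS](big_set0 1 *%R q) -sum_subset_weight_supset.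
by apply: eq_bigr => I _; rewrite finset.sub0set mulr1.
Qed.

Lemma sum_subset_weight_mem q x :
  \sum_I subset_weight q I * (x \in I)%:R = q x.
Proof.
rewrite -[RHS](big_set1 *%R x q) -sum_subset_weight_supset.
by apply: eq_bigr => I _; rewrite finset.sub1set.
Qed.

Lemma sum_subset_weight_mem2 q x y : x != y ->
  \sum_I subset_weight q I * ((x \in I)%:R * (y \in I)%:R) = q x * q y.
Proof.
move=> xy; transitivity (\prod_(u in [set x; y]%SET) q u); last first.
  by rewrite big_setU1 ?big_set1 // !inE.
rewrite -sum_subset_weight_supset.
by apply: eq_bigr => I _; rewrite finset.subUset !finset.sub1set -natrM mulnb.
Qed.

(** Expand [#|I|] into indicators: the term y = x gives [q x], and each other y gives [q x * q y] by
    independence. *)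
Lemma sum_subset_weight_card q x :
  \sum_I subset_weight q I * ((x \in I)%:R * #|I|%:R)
  = q x * (1 + \sum_(y | y != x) q y).
Proof.
transitivity (\sum_y \sum_I subset_weight q I * ((x \in I)%:R * (y \in I)%:R)).
  rewrite exchange_big /=; apply: eq_bigr => I _.
  rewrite -!mulr_sumr -natr_sum -sum1_card big_mkcond.
  by do 3 f_equal; apply: eq_bigr => y _; case: (y \in I).
rewrite (bigD1 x) //= mulrDr mulr1; congr (_ + _).
  rewrite -[RHS]sum_subset_weight_mem; apply: eq_bigr => I _.
  by rewrite -natrM mulnb andbb.
rewrite mulr_sumr; apply: eq_bigr => y yx.
by rewrite sum_subset_weight_mem2 // eq_sym.
Qed.
End random_subset.

(* Conditioning on the coordinate w makes the other factors independent. *)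
Lemma sum_ffun_condition (R : comPzRingType) (T U : finType) (w : T)
    (F : T -> U -> U -> R) :
  \sum_(f : {ffun T -> U}) \prod_v F v (f v) (f w)
  = \sum_j F w j j * \prod_(v | v != w) \sum_i F v i j.
Proof.
transitivity (\sum_j \sum_(f : {ffun T -> U})
    \prod_v (if v == w then (f v == j)%:R * F v (f v) j else F v (f v) j)).
  rewrite exchange_big /=; apply: eq_bigr => f _.
  rewrite (bigD1 (f w)) //= [X in _ = _ + X]big1 ?addr0; last first.
    by move=> j /negbTE jf; rewrite (bigD1 w) //= eqxx eq_sym jf !mul0r.
  by apply: eq_bigr => v _; case: eqP => // ->; rewrite eqxx mul1r.
apply: eq_bigr => j _.
rewrite -(bigA_distr_bigA (fun v i => if v == w then (i == j)%:R * F v i j else F v i j)) /=.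
rewrite (bigD1 w) //=; congr (_ * _).
  rewrite (bigD1 j) //= !eqxx mul1r big1 ?addr0 // => i /negbTE ->.
  by rewrite mul0r.
by apply: eq_bigr => v /negbTE vw; apply: eq_bigr => i _; rewrite vw.
Qed.

(** * Averaging over the graph *)

Section gnp.
Context {R : realType} (n : nat) (p : R).
Hypotheses (p0 : 0 < p) (p1 : p < 1).
Implicit Types (E : graph n) (I : {set 'I_n}).

Definition edge_prob (v u : 'I_n) : R := if u == v then 0 else p.

Lemma edge_prob_itv v u : 0 <= edge_prob v u <= 1.
Proof. by rewrite /edge_prob; case: ifP => _; rewrite ?lexx ?ler01 // !ltW. Qed.

Lemma gnp_weight_ge0 E : 0 <= gnp_weight p E.
Proof. by apply: prodr_ge0 => e _; do 2 case: ifP => // _; rewrite ?subr_ge0 ltW. Qed.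

(** Edges are independent, so the in-neighbourhoods are independent random subsets; [h] is the
    bijection rebuilding a graph from them. *)
Lemma sum_gnp (G : {ffun 'I_n -> {set 'I_n}} -> R) :
  \sum_E gnp_weight p E * G [ffun v => in_nbrs E v]
  = \sum_(f : {ffun 'I_n -> {set 'I_n}}) (\prod_v subset_weight (edge_prob v) (f v)) * G f.
Proof.
pose h (f : {ffun 'I_n -> {set 'I_n}}) : graph n := [set e | e.1 \in f e.2]%SET.
have hK : cancel h (fun E => [ffun v => in_nbrs E v]).
  by move=> f; apply/ffunP => v; apply/finset.setP => u; rewrite ffunE !inE.
rewrite (reindex h) /=; last first.
  exists (fun E => [ffun v => in_nbrs E v]) => [f _|E _]; first exact: hK.
  by apply/finset.setP => -[u v]; rewrite !inE ffunE !inE.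
apply: eq_bigr => f _; rewrite hK; congr (_ * _).
rewrite /gnp_weight /subset_weight exchange_big pair_big /=; apply: eq_bigr => -[u v] _ /=.
rewrite /edge_prob inE /=; case: eqP => _; case: (u \in f v) => //=.
by rewrite subr0.
Qed.

Definition pool_rate (a : algo) : R := if a is R1 then p else 1.

Lemma pool_rate_gt0 a : 0 < pool_rate a.
Proof. by case: a. Qed.

(** The term 1 + n m dominates the mean pool size given that [x] is in the in-neighbourhood; the 1
    accounts for [x] itself. *)
Definition hit_rate (a : algo) (k : nat) : R :=
  k%:R / (k%:R + 1 + n%:R * pool_rate a).

Lemma hit_rate_itv a k : 0 <= hit_rate a k <= 1.
Proof.
have k0 : (0 : R) <= k%:R by [].
have m0 : 0 <= n%:R * pool_rate a by rewrite mulr_ge0 // ltW ?pool_rate_gt0.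
by rewrite /hit_rate divr_ge0 ?ler_pdivrMr; lra.
Qed.

(* For R1 this is Jensen's inequality for y |-> 1/y, by a tangent line. *)
Lemma expected_miss_bound a k (x v : 'I_n) : x != v ->
  p * hit_rate a k
  <= \sum_I subset_weight (edge_prob v) I * miss_bound a k x I.
Proof.
move=> xv; have qx : edge_prob v x = p by rewrite /edge_prob (negbTE xv).
have k0 : (0 : R) <= k%:R by [].
have n0 : (0 : R) <= n%:R by [].
have W0 I := subset_weight_ge0 I (edge_prob_itv v).
rewrite /hit_rate /miss_bound; case: a => /=; last first.
  under eq_bigr do rewrite (mulrA (subset_weight _ _)).
  rewrite -mulr_suml sum_subset_weight_mem qx ler_wpM2l ?(ltW p0) //.
  have n1 : (1 : R) <= n%:R by rewrite ler1n (leq_ltn_trans (leq0n x)).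
  by rewrite ler_wpM2l // lef_pV2 ?posrE; lra.
set B := k%:R + 1 + n%:R * p.
have B0 : 0 < B by have := mulr_ge0 n0 (ltW p0); rewrite /B; lra.
(* The tangent at [B] gives 1/y >= (2 B - y) / B^2, equivalent to (B - y)^2 >= 0. With y = k + |I|
   it is linear in |I|, so its average is a first moment. *)
apply: (@le_trans _ _ (\sum_I (k%:R / B ^+ 2 * (2 * B - k%:R) *
    (subset_weight (edge_prob v) I * (x \in I)%:R)
  - k%:R / B ^+ 2 * (subset_weight (edge_prob v) I * ((x \in I)%:R * #|I|%:R))))).
  rewrite sumrB -!mulr_sumr sum_subset_weight_mem sum_subset_weight_card qx.
  have S : \sum_(y | y != x) edge_prob v y <= n%:R * p.
    apply: (@le_trans _ _ (\sum_(y < n) p)); last first.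
      by rewrite sumr_const card_ord mulr_natl.
    rewrite [leRHS](bigD1 x) //= -[leLHS]add0r lerD ?(ltW p0) //.
    by apply: ler_sum => y _; rewrite /edge_prob; case: ifP => // _; rewrite ltW.
  set s := \sum_(y | _) _ in S *.
  rewrite -subr_ge0.
  (* The slack is a nonnegative multiple of n p - s, where 1 + s is the mean of |I| given that [x]
     is in I. *)
  have -> : k%:R / B ^+ 2 * (2 * B - k%:R) * p - k%:R / B ^+ 2 * (p * (1 + s))
      - p * (k%:R / B) = k%:R / B ^+ 2 * (p * (n%:R * p - s)).
    by rewrite /B; field; rewrite -/B gt_eqF.
  by rewrite !mulr_ge0 ?invr_ge0 ?exprn_ge0 ?(ltW B0) ?(ltW p0) ?subr_ge0.
apply: ler_sum => I _; case: (boolP (x \in I)) => xI; last first.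
  by rewrite !(mulr0, mul0r) subr0.
have I0 : (0 : R) < #|I|%:R by rewrite ltr0n; apply/card_gt0P; exists x.
have -> : k%:R / B ^+ 2 * (2 * B - k%:R) * (subset_weight (edge_prob v) I * true%:R)
  - k%:R / B ^+ 2 * (subset_weight (edge_prob v) I * (true%:R * #|I|%:R))
  = subset_weight (edge_prob v) I * (true%:R * (k%:R * ((2 * B - (k%:R + #|I|%:R)) / B ^+ 2))).
  by field; rewrite gt_eqF.
rewrite ler_wpM2l // !mul1r ler_wpM2l //.
set y := k%:R + _; have y0 : 0 < y by rewrite /y; lra.
rewrite ler_pdivrMr ?exprn_gt0 // [leRHS]mulrC ler_pdivlMr //.
by have := sqr_ge0 (B - y); rewrite sqrrB !expr2; lra.
Qed.

(** Two nested averages: given J = I_w, each v in J outside {x, w} contributes at most 1 - p *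
    [hit_rate]; then v lies in J with probability p, which turns the factor into 1 - p^2 *
    [hit_rate]. *)
Lemma gnp_miss_le a k (x w : 'I_n) : x != w ->
  \sum_E gnp_weight p E * \prod_v miss a E x w v ^+ k
  <= (1 - p ^+ 2 * hit_rate a k) ^+ (n - 2).
Proof.
(* The factors of [x] and [w] are bounded by 1: [edge_prob] gives no mass to x in I_x, and I_w is
   the set conditioned on. This leaves n - 2 factors. *)
move=> xw; pose X : {set 'I_n} := [set x; w]%SET.
pose h (v : 'I_n) (I J : {set 'I_n}) : R :=
  if v \in X then 1 else 1 - (v \in J)%:R * miss_bound a k x I.
pose H (f : {ffun 'I_n -> {set 'I_n}}) := \prod_v h v (f v) (f w).
have W0 v I := subset_weight_ge0 I (edge_prob_itv v).
have r01 := hit_rate_itv a k.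
apply: (@le_trans _ _ (\sum_E gnp_weight p E * H [ffun v => in_nbrs E v])).
  apply: ler_sum => E _; rewrite ler_wpM2l ?gnp_weight_ge0 //.
  apply: ler_prod => v _; have m01 := @miss_itv R n a E x w v.
  rewrite exprn_ge0; last by case/andP: m01.
  rewrite /h !ffunE; case: ifP => _; last exact: missX_le.
  by rewrite exprn_ile1; case/andP: m01.
rewrite sum_gnp /H.
under eq_bigr do rewrite -big_split /=.
rewrite (sum_ffun_condition w (fun v I J => subset_weight (edge_prob v) I * h v I J)).
pose c (v : 'I_n) : R := if v \in X then 0 else p * hit_rate a k.
have c01 v : 0 <= c v <= 1.
  rewrite /c; case: ifP => _; first by rewrite lexx ler01.
  case/andP: r01; move: (hit_rate a k) => r r0 r1.
  by rewrite mulr_ge0 ?mulr_ile1 // ltW.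
apply: (@le_trans _ _ (\sum_J subset_weight (edge_prob w) J *
    \prod_v (if v \in J then 1 - c v else 1))).
  apply: ler_sum => J _; rewrite /h !inE eqxx orbT mulr1 ler_wpM2l //.
  rewrite [leRHS](bigD1 w) //= {1}/c !inE eqxx orbT subr0 if_same mul1r.
  apply: ler_prod => v vw; apply/andP; split.
    apply: sumr_ge0 => I _; rewrite mulr_ge0 //.
    have /andP[_ b1] := @miss_bound_itv R n a k x I; case: ifP => // _.
    by case: (v \in J); rewrite ?mul1r ?mul0r ?subr0 ?subr_ge0.
  rewrite /c !inE (negbTE vw) orbF; case: eqP => [_|/eqP vx].
    by under eq_bigr do rewrite mulr1; rewrite sum_subset_weight subr0 if_same.
  case: (v \in J); last first.
    by under eq_bigr do rewrite mul0r subr0 mulr1; rewrite sum_subset_weight.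
  under eq_bigr do rewrite mul1r mulrBr mulr1.
  rewrite sumrB sum_subset_weight lerD2l lerN2 expected_miss_bound //.
  by rewrite eq_sym.
rewrite sum_subset_weight_prod le_eqVlt; apply/orP; left; apply/eqP.
transitivity (\prod_(v in (~: X)%SET) (1 - p ^+ 2 * hit_rate a k)).
  rewrite [RHS]big_mkcond; apply: eq_bigr => v _; rewrite finset.in_setC /c.
  case: (boolP (v \in X)) => /= [_|]; first by ring.
  by rewrite !inE negb_or => /andP[_ /negbTE vw]; rewrite /edge_prob vw; ring.
by rewrite prodr_const cardsCs finset.setCK cards2 xw card_ord.
Qed.

(** After round 1 every node holds its in-neighbours' packets and K - 1 random rounds remain. At
    most n^2 pairs are summed, and 1 - y <= exp(-y). *)
Lemma prob_T_gt_le a K : (0 < K)%N -> (1 < n)%N ->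
  prob_T_gt n p a K <=
  n%:R ^+ 2 * expR (- (p ^+ 2 * (n%:R - 2) * hit_rate a K.-1)).
Proof.
case: K => // k _ n1 /=.
pose B := expR (- (p ^+ 2 * (n%:R - 2) * hit_rate a k)).
apply: (@le_trans _ _ (\sum_E gnp_weight p E *
   \sum_(xw : 'I_n * 'I_n | xw.1 != xw.2) \prod_v miss a E xw.1 xw.2 v ^+ k)).
  apply: ler_sum => E _; rewrite ler_wpM2l ?gnp_weight_ge0 //=.
  apply: le_trans (notdone_le a k (isT : (0 < 1)%N) _) _.
    move=> v; apply/fintype.subsetP => u; rewrite inE => uv.
    rewrite ffunE !inE; apply/orP; right; apply/existsP; exists u.
    by rewrite uv ffunE eqxx.
  apply: ler_sum => -[x w] _ /=; rewrite ler_piMl ?lern1 ?leq_b1 //.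
  by apply: prodr_ge0 => v _; rewrite exprn_ge0 //; case/andP: (@miss_itv R n a E x w v).
under eq_bigr do rewrite mulr_sumr.
rewrite exchange_big /=.
apply: (@le_trans _ _ (\sum_(xw : 'I_n * 'I_n) B)); last first.
  by rewrite sumr_const card_prod card_ord -[leLHS]mulr_natl natrM -expr2.
rewrite big_mkcond /=; apply: ler_sum => -[x w] _ /=.
case: ifP => xw; last exact: expR_ge0.
apply: le_trans (gnp_miss_le a k xw) _.
have /andP[r0 r1] := hit_rate_itv a k.
have c1 : p ^+ 2 * hit_rate a k <= 1.
  by apply: mulr_ile1; rewrite ?exprn_ge0 ?exprn_ile1 // ltW.
rewrite /B [X in expR X](_ : _ = (n - 2)%:R * - (p ^+ 2 * hit_rate a k)); last first.
  by rewrite natrB //; ring.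
rewrite expRM_natl.
by rewrite lerXn2r ?nnegrE ?expR_ge0 ?subr_ge0 //; exact: expR_ge1Dx.
Qed.
End gnp.

(** * Asymptotics *)

Section asymptotics.
Context {R : realType}.

Lemma cvgry_ln_natr : ln (n%:R : R) @[n --> \oo] --> +oo.
Proof.
apply/cvgryPge => A; near=> n.
have An : expR A <= n%:R by near: n; exact: nbhs_infty_ger.
by rewrite -[A]expRK ler_ln ?posrE ?expR_gt0 // (lt_le_trans (expR_gt0 A)).
Unshelve. all: by end_near.
Qed.

(** With l = ln y, exp(l) >= l^2 / 2, and c l >= 2 makes c l^2 / 2 at least l. *)
Lemma ln_le_linear (c : R) (y : R) : 0 < c -> 0 < y -> 2 / c <= ln y -> ln y <= c * y.
Proof.
move=> c0 y0 cy; have ly0 : 0 < ln y by rewrite (lt_le_trans _ cy) // divr_gt0.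
have := expR_ge1Dxn 1 (ltW ly0).
rewrite lnK ?posrE // => /(ler_wpM2l (ltW c0)); apply: le_trans.
move: cy; rewrite ler_pdivrMr // => cy.
have := ler_wpM2r (ltW ly0) cy; rewrite -[2`!]/2%N expr2; lra.
Qed.

(** The margin [d] absorbs lower-order terms: k >= (1 - d) L x, N - 2 >= (1 - d) N and k + 1 + N m
    <= (1 + d) N m. The inequality on [d] then leaves at least (2 + eps) x to set against 2 x. *)
Lemma exponent_le (p eps m d L x N k : R) :
  0 < p -> 0 < eps -> 0 < m -> 0 < d -> d < 1 -> 0 < x ->
  L * p ^+ 2 = 2 * (1 + eps) * m ->
  (2 + eps) * (1 + d) <= 2 * (1 + eps) * (1 - d) ^+ 2 ->
  L * x <= k + 2 -> k + 1 <= L * x -> 0 <= k ->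
  2 <= d * (L * x) -> L * x <= d * m * N -> 2 <= d * N ->
  2 * x - p ^+ 2 * (N - 2) * (k / (k + 1 + N * m)) <= - (eps * x).
Proof.
move=> p0 e0 m0 d0 d1 x0 Lp ed kL Lk k0 dLx Lxm dN.
have N0 : 0 < N by rewrite -(pmulr_rgt0 _ d0); lra.
have Nm : 0 < N * m by rewrite mulr_gt0.
have Lx0 : 0 <= L * x by lra.
suff : (2 + eps) * x <= p ^+ 2 * (N - 2) * (k / (k + 1 + N * m)) by lra.
rewrite [leRHS]mulrA ler_pdivlMr; last by lra.
apply: (@le_trans _ _ ((2 + eps) * x * ((1 + d) * (N * m)))).
  by rewrite ler_wpM2l ?mulr_ge0; lra.
apply: (@le_trans _ _ (p ^+ 2 * ((1 - d) * N) * ((1 - d) * (L * x)))); last first.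
  have p2 : 0 <= p ^+ 2 by rewrite exprn_ge0 // ltW.
  have d1' : 0 <= 1 - d by lra.
  apply: ler_pM; [|exact: mulr_ge0|apply: ler_wpM2l => //; lra|lra].
  by apply: mulr_ge0 => //; apply: mulr_ge0 => //; exact: ltW.
have := ler_wpM2r (ltW (mulr_gt0 x0 Nm)) ed.
rewrite [X in X <= _ -> _](_ : _ = (2 + eps) * x * ((1 + d) * (N * m))); last by ring.
move=> /le_trans; apply; rewrite le_eqVlt; apply/orP; left; apply/eqP.
transitivity ((1 - d) ^+ 2 * x * N * (2 * (1 + eps) * m)); first by ring.
by rewrite -Lp; ring.
Qed.

Lemma prob_T_gt_real_ge0 n (p : R) a y : 0 < p -> p < 1 ->
  0 <= prob_T_gt_real n p a y.
Proof.
move=> p0 p1; apply: sumr_ge0 => E _; apply: mulr_ge0; first exact: gnp_weight_ge0.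
move: (Num.truncn y) (0%N) (state0 n) => K.
elim: K => [|K IH] t S /=; first by case: ifP.
by case: ifP => // _; apply: sumr_ge0 => b _; rewrite mulr_ge0 ?bcast_weight_ge0.
Qed.

(** For large n the union bound is at most n^(-eps), so the probability is squeezed to 0;
    [pool_rate] treats both algorithms at once. *)
Lemma cvg_prob_T_gt_real (p eps : R) (a : algo) : 0 < p -> p < 1 -> 0 < eps ->
  prob_T_gt_real n p a (2 * (1 + eps) * pool_rate p a / p ^+ 2 * ln (n%:R))
    @[n --> \oo] --> (0 : R).
Proof.
move=> p0 p1 e0; have m0 := pool_rate_gt0 p0 a.
set m := pool_rate p a in m0 *; set L := _ / _.
have p2 : 0 < p ^+ 2 by rewrite exprn_gt0.
have L0 : 0 < L by rewrite divr_gt0 // !mulr_gt0 //; lra.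
have Lp : L * p ^+ 2 = 2 * (1 + eps) * m by rewrite /L divfK ?gt_eqF.
(* Chosen so that 2 + eps = 2 (1 + eps) (1 - 3 d); then [ed] reduces to (1 - 3 d) (1 + d) <= (1 -
   d)^2. *)
pose d : R := eps / (6 * (1 + eps)).
have e1 : 0 < 6 * (1 + eps) by lra.
have d0 : 0 < d by rewrite divr_gt0.
have de : eps = 6 * (1 + eps) * d by rewrite /d mulrC divfK ?gt_eqF.
have d1 : d < 1 by rewrite ltr_pdivrMr // mul1r; lra.
have ed : (2 + eps) * (1 + d) <= 2 * (1 + eps) * (1 - d) ^+ 2.
  rewrite (_ : 2 + eps = 2 * (1 + eps) * (1 - 3 * d)); last by lra.
  rewrite -mulrA ler_wpM2l //; first lra.
  by have := sqr_ge0 d; rewrite !expr2; lra.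
have lny A : \forall n \near \oo, A <= ln (n%:R : R).
  by have /cvgryPge := cvgry_ln_natr; exact.
apply: (@squeeze_cvgr _ _ _ _ (fun=> 0) (fun n => expR (- (eps * ln n%:R)))).
- near=> n; rewrite prob_T_gt_real_ge0 //=.
  have n2 : 2 <= n%:R :> R by near: n; exact: nbhs_infty_ger.
  have n0 : 0 < n%:R :> R by lra.
  have x0 : 1 <= ln (n%:R : R) by near: n; exact: lny.
  have dLx : 2 / d / L <= ln (n%:R : R) by near: n; exact: lny.
  have Lxm : 2 / (d * m / L) <= ln (n%:R : R) by near: n; exact: lny.
  have dN : 2 / d <= n%:R :> R by near: n; exact: nbhs_infty_ger.
  set x := ln n%:R in x0 dLx Lxm *.
  have {}Lxm : L * x <= d * m * n%:R.
    have := ln_le_linear (divr_gt0 (mulr_gt0 d0 m0) L0) n0 Lxm.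
    by rewrite -/x mulrAC ler_pdivlMr // mulrC.
  have {}dN : 2 <= d * n%:R by move: dN; rewrite ler_pdivrMr // mulrC.
  have Lx2 : 2 / d <= L * x by move: dLx; rewrite ler_pdivrMr // (mulrC x).
  have {}dLx : 2 <= d * (L * x) by move: Lx2; rewrite ler_pdivrMr // mulrC.
  have Lx1 : 1 <= L * x.
    apply: le_trans Lx2; rewrite ler_pdivlMr //; lra.
  have /andP[Kl Ku] := truncn_itv (le_trans ler01 Lx1).
  have K0 : (0 < Num.truncn (L * x))%N by rewrite truncn_gt0.
  apply: le_trans (prob_T_gt_le p0 p1 a K0 _) _; first by move: n2; rewrite ler_nat.
  (* [k] counts the rounds after the first, so truncation gives k + 1 <= L x < k + 2. *)
  set k := (Num.truncn _).-1.
  have kE : (Num.truncn (L * x))%:R = k%:R + 1 :> R by rewrite natr1 prednK.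
  rewrite -natr1 kE in Ku; rewrite kE in Kl.
  have -> : n%:R ^+ 2 = expR (2 * x) by rewrite expRM_natl lnK.
  rewrite -expRD ler_expR /hit_rate -/m.
  by apply: exponent_le ed _ _ _ dLx Lxm dN => //; lra.
- exact: cvg_cst.
- apply: (cvg_comp _ _ _ (@cvgr_expR R)).
  by apply/cvgryPge => A; near=> n; rewrite mulrC -ler_pdivrMr //; near: n; exact: lny.
Unshelve. all: by end_near.
Qed.
End asymptotics.

Unset Implicit Arguments. Set Strict Implicit.

Theorem theorem1 (R : realType) (p eps : R) (hp0 : 0 < p) (hp1 : p < 1)
  (heps : 0 < eps) :
  (fun n : nat => prob_T_gt_real n p R1 (2 * (1 + eps) / p * ln (n%:R)))
     @ \oo --> (0 : R) /\
  (fun n : nat => prob_T_gt_real n p R2 (2 * (1 + eps) / (p ^+ 2) * ln (n%:R)))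
     @ \oo --> (0 : R).
Proof.
split.
  have -> : 2 * (1 + eps) / p = 2 * (1 + eps) * pool_rate p R1 / p ^+ 2.
    by rewrite /=; field; rewrite gt_eqF.
  exact: cvg_prob_T_gt_real.
have -> : 2 * (1 + eps) / p ^+ 2 = 2 * (1 + eps) * pool_rate p R2 / p ^+ 2.
  by rewrite /= mulr1.
exact: cvg_prob_T_gt_real.
Qed.
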